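(* Let $k\ge 2$ be an integer and let $d$ be a positive integer such that $k+1$ is a proper divisor of $d$. Then there exists a $d$-dimensional lattice polytope $P$ with $(k+2)^{d/(k+1)}$ vertices contained in $[0,k]^d$ such that every lattice point $x\in\mathbb{Z}^d\cap[0,k]^d$ can either be inserted in $P$ or deleted from $P$.
   Context: A lattice polytope in $\mathbb{R}^d$ is a polytope whose vertices all belong to $\mathbb{Z}^d$. Let $P\subset\mathbb{R}^d$ be a $d$-dimensional polytope with vertex set $\mathcal{V}$. A point $x\in\mathbb{R}^d\setminus P$ can be inserted in $P$ if the vertex set of the convex hull of $P\cup\{x\}$ is exactly $\mathcal{V}\cup\{x\}$ (points of $P$ itself are never insertable). A point $v$ can be deleted from $P$ if $v\in\mathcal{V}$ and the convex hull of $\mathcal{V}\setminus\{v\}$ is still $d$-dimensional. *)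

(* Defs.v *)
(* Points of R^d are row vectors 'rV[R]_d. *)
From mathcomp Require Import all_boot all_order all_algebra.
From mathcomp Require Import classical_sets cardinality reals convex.

Set Implicit Arguments.
Unset Strict Implicit.
Unset Printing Implicit Defensive.

Import GRing.Theory Num.Theory.
Local Open Scope classical_set_scope.
Local Open Scope ring_scope.

Definition conv_hull (R : realType) (d : nat) (A : set 'rV[R]_d) :
    set 'rV[R]_d :=
  smallest (@convex_set R 'rV[R]_d) A.

Definition affine_set (R : realType) (d : nat) (A : set 'rV[R]_d) : Prop :=
  forall (x y : 'rV[R]_d) (t : R), A x -> A y -> A (t *: x + (1 - t) *: y).

Definition aff_hull (R : realType) (d : nat) (A : set 'rV[R]_d) :
    set 'rV[R]_d :=
  smallest (@affine_set R d) A.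

(* The affine hull of A is a translate of an n-dimensional linear subspace;
   no n qualifies when A is empty. *)
Definition has_dim (R : realType) (d : nat) (A : set 'rV[R]_d) (n : nat) :
    Prop :=
  exists (a : 'rV[R]_d) (U : {vspace 'rV[R]_d}),
    aff_hull A = [set a + u | u in [set u | u \in U]] /\ \dim U = n.

Definition polytope (R : realType) (d : nat) (P : set 'rV[R]_d) : Prop :=
  exists F : set 'rV[R]_d, finite_set F /\ P = conv_hull F.

(* The points of P at which the linear form x |-> x *m c is maximal on P;
   vertices are the faces reduced to a point. *)
Definition face (R : realType) (d : nat) (P : set 'rV[R]_d) (c : 'cV[R]_d) :
    set 'rV[R]_d :=
  [set x | P x /\ forall y, P y -> (y *m c) 0 0 <= (x *m c) 0 0].

Definition vertices (R : realType) (d : nat) (P : set 'rV[R]_d) :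
    set 'rV[R]_d :=
  [set v | exists c : 'cV[R]_d, face P c = [set v]].

Definition lattice (R : realType) (d : nat) : set 'rV[R]_d :=
  [set x | forall i : 'I_d, x 0 i \is a Num.int].

Definition lattice_polytope (R : realType) (d : nat) (P : set 'rV[R]_d) :
    Prop :=
  polytope P /\ vertices P `<=` @lattice R d.

Definition cube (R : realType) (d k : nat) : set 'rV[R]_d :=
  [set x | forall i : 'I_d, 0 <= x 0 i <= k%:R].

Definition insertable (R : realType) (d : nat) (P : set 'rV[R]_d)
    (x : 'rV[R]_d) : Prop :=
  ~ P x /\ vertices (conv_hull (P `|` [set x])) = vertices P `|` [set x].

Definition deletable (R : realType) (d : nat) (P : set 'rV[R]_d)
    (v : 'rV[R]_d) : Prop :=
  vertices P v /\ has_dim (conv_hull (vertices P `\ v)) d.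

(* Main.v *)
Require Import Defs.
From mathcomp Require Import all_boot all_order all_algebra.
From mathcomp Require Import boolp classical_sets cardinality reals convex.
From mathcomp Require Import interval_inference.
From mathcomp Require Import ring lra zify.

Set Implicit Arguments.
Unset Strict Implicit.
Unset Printing Implicit Defensive.

Import Order.TTheory GRing.Theory Num.Theory.
Local Open Scope classical_set_scope.

(** Let [n = k + 1] and [d = m * n], so that [m >= 2].  The polytope is the
    product [S ^ m] of copies of one lattice simplex [S] of dimension [n] in
    the cube [[0, k] ^ n], which has [n + 1 = k + 2] vertices.

    A point outside a polytope can be inserted as soon as no old vertex gets
    swallowed by the new hull, and the vertex [v] is swallowed by [x] exactly
    when [x] lies in the cone opposite to the polytope at [v].  For a simplex
    this cone is where every barycentric coordinate except that of [v] is at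
    most 0, and for a product it is the product of the cones.  Hence it is
    enough that the lattice points [r] of [[0, k] ^ n] satisfy
    - if all barycentric coordinates of [r] are nonnegative, [r] is a vertex;
    - if all of them but the one of a vertex [v] are nonpositive, [r] is [v].
    These two properties make up [movable_simplex], and [insertable_product]
    derives insertability in [S ^ m] from them.  All vertices, old and new,
    are certified by linear forms: minus a barycentric coordinate that is
    negative at [x] singles out [x], and the sum of the coordinates of an old
    vertex, corrected by a large multiple of a coordinate that is positive at
    [x], singles out that vertex.  Any vertex of [S ^ m] can be deleted because
    two factors can be modified independently: it is the fourth corner of a
    parallelogram of vertices, so the others still span the space affinely
    ([deletable_product]).

    The simplex: for [k >= 3], take the origin and the points
    [(k - 1) e_i + e_{i+1}], with indices modulo [n].  With barycentric
    coordinates [y_i] the point [r] has entries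
    [r_i = (k - 1) y_i + y_{i-1}] summing to [k] times the sum of the [y_i].
    If all coordinates are nonnegative, the entries sum to at most [k < n], so
    some entry and thus some [y_i] vanishes; unless [r] is the origin, the [y_i]
    go somewhere from nonzero to zero along the cycle, and there an entry of
    [r] equals a nonzero [y_i], which is then an integer, so [y_i = 1]
    and [r] is a vertex.  In an opposite cone, nonnegativity of the entries of
    [r] kills every nonpositive [y_i]; when the cone is at a point other than
    the origin, the remaining [y_i] is an integer between 1 and
    [k / (k - 1) < 2].  This last inequality fails for [k = 2]; a unimodular
    simplex settles that case by a finite integer computation. *)

(** * Hulls, exposed points and affine spans *)

Section Hulls.
Local Open Scope ring_scope.
Variables (R : realType) (d : nat).
Implicit Types (V S : set 'rV[R]_d) (c : 'cV[R]_d) (x y v w : 'rV[R]_d).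

Lemma convex_setP S :
  (forall x y (t : R), 0 <= t -> t <= 1 -> S x -> S y ->
     S (t *: x + (1 - t) *: y)) -> convex_set S.
Proof.
move=> cS x y t; rewrite !inE => Sx Sy.
exact: (cS x y t%:num (ge0 t) (le1 t)).
Qed.

Lemma convex_conv_hull V : convex_set (conv_hull V).
Proof.
move=> x y t; rewrite !inE => Vx Vy S [cS VS].
by have := cS x y t; rewrite !inE; apply; [exact: Vx|exact: Vy].
Qed.

Lemma sub_conv_hull V : V `<=` conv_hull V.
Proof. exact: sub_gen_smallest. Qed.

Lemma conv_hull_min V S : convex_set S -> V `<=` S -> conv_hull V `<=` S.
Proof. exact: smallest_sub. Qed.

Lemma mulmx_comb00 x y c (s t : R) :
  ((s *: x + t *: y) *m c) 0 0 = s * (x *m c) 0 0 + t * (y *m c) 0 0.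
Proof. by rewrite mulmxDl -!scalemxAl !mxE. Qed.

Lemma convex_open_halfspace c (b : R) :
  convex_set [set y : 'rV[R]_d | (y *m c) 0 0 < b].
Proof.
apply: convex_setP => x y t t0 t1 /= xb yb; rewrite mulmx_comb00.
by have [xy|yx] := leP ((x *m c) 0 0) ((y *m c) 0 0); nra.
Qed.

Lemma conv_hullU1 V x :
  conv_hull (conv_hull V `|` [set x]) = conv_hull (V `|` [set x]).
Proof.
apply/seteqP; split.
  apply: conv_hull_min; first exact: convex_conv_hull.
  move=> y [|->]; last by apply: sub_conv_hull; right.
  apply: conv_hull_min; first exact: convex_conv_hull.
  by move=> z Vz; apply: sub_conv_hull; left.
apply: conv_hull_min; first exact: convex_conv_hull.
move=> y [Vy|->]; apply: sub_conv_hull; last by right.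
by left; apply: sub_conv_hull.
Qed.

Definition strictly_exposed V v : Prop :=
  exists c, forall w, V w -> w <> v -> (w *m c) 0 0 < (v *m c) 0 0.

Lemma strictly_exposedS V S v :
  S `<=` V -> strictly_exposed V v -> strictly_exposed S v.
Proof. by move=> SV [c ce]; exists c => w /SV; apply: ce. Qed.

(** A linear form exposing [v] keeps the whole hull of the other points in an
    open half-space that misses [v]. *)
Lemma strictly_exposed_notin_hull V v :
  strictly_exposed V v -> ~ V v -> ~ conv_hull V v.
Proof.
move=> [c ce] nVv Vv.
suff /(_ v Vv) : conv_hull V `<=` [set y | (y *m c) 0 0 < (v *m c) 0 0].
  by rewrite /= ltxx.
apply: conv_hull_min; first exact: convex_open_halfspace.
by move=> w Vw; apply: ce => // wv; apply: nVv; rewrite -wv.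
Qed.

(** A vertex of the hull outside [V] would be strictly exposed with respect to
    [V], which contradicts its membership in the hull. *)
Lemma vertices_conv_hull_sub V : vertices (conv_hull V) `<=` V.
Proof.
move=> v [c fv]; apply: contrapT => nVv.
have [Vv vmax] : face (conv_hull V) c v by rewrite fv.
apply: (@strictly_exposed_notin_hull V v) => //.
exists c => w Vw wv; rewrite lt_neqAle vmax ?andbT; last exact: sub_conv_hull.
apply/eqP => cwv; apply: wv.
suff : face (conv_hull V) c w by rewrite fv.
split=> [|y Vy]; first exact: sub_conv_hull.
by rewrite cwv; apply: vmax.
Qed.

(** The open half-space of the exposing form becomes a set containing all of
    [V], and remains convex, once [v] is added to it. *)
Lemma strictly_exposed_vertex V v :
  V v -> strictly_exposed V v -> vertices (conv_hull V) v.
Proof.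
move=> Vv [c ce]; exists c.
set H := [set y : 'rV[R]_d | y = v \/ (y *m c) 0 0 < (v *m c) 0 0].
have cH : convex_set H.
  apply: convex_setP => x y t t0 t1 Hx Hy; rewrite /H /=.
  have [-> | tn0] := eqVneq t 0.
    by rewrite scale0r add0r subr0 scale1r.
  have [-> | tn1] := eqVneq t 1.
    by rewrite scale1r subrr scale0r addr0.
  have {tn0}t0 : 0 < t by rewrite lt_neqAle eq_sym tn0.
  have {tn1}t1 : t < 1 by rewrite lt_neqAle tn1.
  case: Hx => [->|Hx]; case: Hy => [->|Hy].
  - by left; rewrite -scalerDl addrC subrK scale1r.
  - by right; rewrite mulmx_comb00; nra.
  - by right; rewrite mulmx_comb00; nra.
  - by right; rewrite mulmx_comb00; nra.
have VH : conv_hull V `<=` H.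
  apply: conv_hull_min => // w Vw; have [->|/eqP wv] := eqVneq w v.
    by left.
  by right; apply: ce.
apply/seteqP; split=> [w [Vw wmax]|w ->].
  case: (VH _ Vw) => // H1.
  by have := wmax v (sub_conv_hull Vv); rewrite leNgt H1.
split=> [|y Vy]; first exact: sub_conv_hull.
by case: (VH _ Vy) => [->//|/ltW].
Qed.

Lemma vertices_conv_hull V :
  (forall v, V v -> strictly_exposed V v) -> vertices (conv_hull V) = V.
Proof.
move=> Ve; apply/seteqP; split; first exact: vertices_conv_hull_sub.
by move=> v Vv; apply: strictly_exposed_vertex => //; apply: Ve.
Qed.

(** Insertability becomes a question about linear forms only: one for [x] and
    one for each old vertex, against all the points of [V] together with [x]. *)
Lemma insertable_conv_hull V x :
  (forall v, V v -> strictly_exposed (V `|` [set x]) v) ->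
  strictly_exposed (V `|` [set x]) x -> ~ V x ->
  insertable (conv_hull V) x.
Proof.
move=> Ve xe nVx; have VU : V `<=` V `|` [set x] by left.
split.
  by apply: strictly_exposed_notin_hull nVx; apply: strictly_exposedS xe.
rewrite conv_hullU1.
have -> : vertices (conv_hull V) = V.
  by apply: vertices_conv_hull => v Vv; apply: strictly_exposedS (Ve v Vv).
by apply: vertices_conv_hull => v [/Ve//|->].
Qed.

(** Affine sets are closed under the two-point combinations only; this is the
    three-point combination from which affine spans are computed. *)
Lemma affine_set_translate S a b z (t : R) :
  affine_set S -> S a -> S b -> S z -> S (z + t *: (b - a)).
Proof.
rewrite /affine_set => aS Sa Sb Sz.
(* Twice the midpoint of z and of a point w of the line ab, minus a. *)
have -> : z + t *: (b - a) =
    2 *: (2^-1 *: z + (1 - 2^-1) *: (t *: b + (1 - t) *: a)) + (1 - 2) *: a.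
  by apply/rowP => i; rewrite !mxE; field.
by do 3!apply: (aS) => //.
Qed.

Lemma has_dim_conv_hull V :
  (forall S, affine_set S -> V `<=` S -> S = setT) -> has_dim (conv_hull V) d.
Proof.
move=> Vfull; exists 0, fullv; split; last by rewrite dimvf /dim /= mul1n.
have -> : aff_hull (conv_hull V) = setT.
  apply/seteqP; split=> // x _ S [aS VS].
  by rewrite (Vfull S) // => y Vy; apply: VS; apply: sub_conv_hull.
by apply/seteqP; split=> // x _; exists x; rewrite ?add0r //= memvf.
Qed.

End Hulls.

(** * Affine forms *)

Section AffineForms.
Local Open Scope ring_scope.
Variables (R : realType) (d : nat).
Implicit Types F G : 'rV[R]_d -> R.

Definition affine_form F : Prop :=
  exists (c : 'cV[R]_d) (b : R), forall x, F x = (x *m c) 0 0 + b.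

Lemma affine_formD F G :
  affine_form F -> affine_form G -> affine_form (fun x => F x + G x).
Proof.
move=> [c [b Fc]] [e [a Ge]]; exists (c + e), (b + a) => x.
by rewrite Fc Ge mulmxDr [X in _ = X + _]mxE addrACA.
Qed.

Lemma affine_formZ (a : R) F : affine_form F -> affine_form (fun x => a * F x).
Proof.
move=> [c [b Fc]]; exists (a *: c), (a * b) => x.
by rewrite Fc -scalemxAr [X in _ = X + _]mxE mulrDr.
Qed.

Lemma affine_form_sum (I : finType) (F : I -> 'rV[R]_d -> R) :
  (forall i, affine_form (F i)) -> affine_form (fun x => \sum_i F i x).
Proof.
move=> Faff; elim: (index_enum I) => [|i s [c [b IH]]].
  by exists 0, 0 => x; rewrite big_nil mulmx0 mxE addr0.
have [e [a Fi]] := Faff i; exists (e + c), (a + b) => x.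
by rewrite big_cons IH Fi mulmxDr [X in _ = X + _]mxE addrACA.
Qed.

Lemma affine_form_exposed F (V : set 'rV[R]_d) v :
  affine_form F -> (forall w, V w -> w <> v -> F w < F v) ->
  strictly_exposed V v.
Proof.
move=> [c [b Fc]] Fv; exists c => w Vw wv.
by have := Fv w Vw wv; rewrite !Fc ltrD2r.
Qed.

End AffineForms.

(** * Barycentric coordinates and movable simplices *)

Section Barycentric.
Local Open Scope ring_scope.
Variables (R : realType) (n : nat).

(** Barycentric coordinates with respect to the standard simplex: [None] is the
    index of the origin, [Some i] that of the unit vector [e_i]. *)
Definition bary (y : 'rV[R]_n) (o : option 'I_n) : R :=
  if o is Some i then y 0 i else 1 - \sum_i y 0 i.

Definition corner (o : option 'I_n) : 'rV[R]_n :=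
  if o is Some i then delta_mx 0 i else 0.

Lemma bary_corner o o' : bary (corner o) o' = (o == o')%:R.
Proof.
case: o o' => [i|] [j|] /=; rewrite ?mxE //=; first by rewrite eq_sym.
  rewrite (bigD1 i) //= mxE !eqxx big1 ?addr0 ?subrr // => j /negbTE ji.
  by rewrite mxE ji andbF.
by rewrite big1 ?subr0 // => j _; rewrite mxE.
Qed.

(** The simplex meant here has the origin and the rows of [A] as vertices;
    [y] ranges over its points in the coordinates given by the rows, so that
    [bary y] lists barycentric coordinates of the point [y *m A].  The last
    clause says that no lattice point of the cube other than a vertex lies in
    the simplex or in the cone opposite to it at a vertex. *)
Definition movable_simplex (k : nat) (A : 'M[R]_n) : Prop :=
  [/\ A \in unitmx,
      forall o, lattice (corner o *m A) /\ cube k (corner o *m A)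
    & forall y, lattice (y *m A) -> cube k (y *m A) ->
        ((forall o, 0 <= bary y o) -> exists o, y = corner o) /\
        (forall o, (forall o', o' != o -> bary y o' <= 0) -> y = corner o)].

End Barycentric.

(** * Products of a movable simplex *)

Lemma card_range_fin (T : finType) (U : Type) (f : T -> U) :
  injective f -> (range f #= `I_#|T|)%card.
Proof.
move=> fI; apply: card_eq_trans (inj_card_eq (in2W fI)) _.
rewrite card_eq_sym.
have <- : range (fun x : T => enum_rank x : nat) = `I_#|T|.
  apply/seteqP; split=> [_ [x _ <-] /=|i /= ilt]; first exact: ltn_ord.
  by exists (enum_val (Ordinal ilt)) => //; rewrite enum_valK.
by apply: inj_card_eq; apply: in2W => x y /ord_inj /enum_rank_inj.
Qed.

Section ProductOfSimplices.
Local Open Scope ring_scope.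
Variables (R : realType) (m n k : nat) (A : 'M[R]_n).
Hypothesis m_gt1 : (1 < m)%N.
Hypothesis n_gt0 : (0 < n)%N.
Hypothesis movA : movable_simplex k A.

Let A_unit : A \in unitmx. Proof. by case: movA. Qed.

Let corners := {ffun 'I_m -> option 'I_n}.
Implicit Types (f g : corners) (x : 'rV[R]_(m * n)).

(* A point of the product is handled through the m by n matrix whose rows are
   its components in the factors: coords and point translate between a point
   and the standard coordinates of its components. *)
Definition corner_mx f : 'M[R]_(m, n) := \matrix_j corner R (f j).
Definition point (Y : 'M[R]_(m, n)) : 'rV[R]_(m * n) := mxvec (Y *m A).
Definition coords x : 'M[R]_(m, n) := vec_mx x *m invmx A.
Definition pvertex f := point (corner_mx f).
Definition bary_coord x j o := bary (row j (coords x)) o.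

Lemma coordsK : cancel coords point.
Proof. by move=> x; rewrite /point /coords mulmxKV // vec_mxK. Qed.

Lemma pointK : cancel point coords.
Proof. by move=> Y; rewrite /point /coords mxvecK mulmxK. Qed.

Lemma bary_coord_pvertex f j o : bary_coord (pvertex f) j o = (f j == o)%:R.
Proof. by rewrite /bary_coord pointK rowK bary_corner. Qed.

Lemma pvertex_inj : injective pvertex.
Proof.
move=> f g fg; apply/ffunP => j; have := bary_coord_pvertex f j (f j).
rewrite fg bary_coord_pvertex eqxx; case: eqP => [//|_] /eqP.
by rewrite eq_sym oner_eq0.
Qed.

Lemma eq_pvertex x f :
  (forall j, row j (coords x) = corner R (f j)) -> x = pvertex f.
Proof.
move=> xf; rewrite -[x]coordsK; congr point.
by apply/row_matrixP => j; rewrite xf rowK.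
Qed.

Lemma row_coords x j : row j (coords x) *m A = row j (vec_mx x).
Proof. by rewrite -row_mul /coords mulmxKV. Qed.

Lemma lattice_row x j : lattice x -> lattice (row j (coords x) *m A).
Proof. by move=> Lx i; rewrite row_coords !mxE. Qed.

Lemma cube_row x j : cube k x -> cube k (row j (coords x) *m A).
Proof. by move=> Cx i; rewrite row_coords !mxE; apply: Cx. Qed.

Lemma pvertex_entry f j i :
  pvertex f 0 (mxvec_index j i) = (corner R (f j) *m A) 0 i.
Proof.
have -> : corner R (f j) *m A = row j (corner_mx f *m A).
  by rewrite row_mul rowK.
by rewrite mxvecE [RHS]mxE.
Qed.

Lemma lattice_pvertex f : lattice (pvertex f).
Proof.
move=> p; case/mxvec_indexP: p => j i; rewrite pvertex_entry.
by case: movA => _ /(_ (f j)) [+ _] _; apply.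
Qed.

Lemma cube_pvertex f : cube k (pvertex f).
Proof.
move=> p; case/mxvec_indexP: p => j i; rewrite pvertex_entry.
by case: movA => _ /(_ (f j)) [_ +] _; apply.
Qed.

Lemma affine_form_bary_coord j o : affine_form (fun x => bary_coord x j o).
Proof.
have coordP i : affine_form (fun x => coords x j i).
  exists (col (mxvec_index j i) (lin_mulmxr (invmx A))), 0 => x.
  rewrite addr0 colE mulmxA -colE [RHS]mxE -[x in RHS]vec_mxK mul_vec_lin /=.
  by rewrite mxvecE.
case: o => [i|].
  have [c [b cb]] := coordP i; exists c, b => x.
  by rewrite -cb /bary_coord /= mxE.
have [c [b cb]] : affine_form (fun x => \sum_i coords x j i).
  exact: affine_form_sum.
exists (- c), (1 - b) => x; transitivity (1 - \sum_i coords x j i).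
  by rewrite /bary_coord /=; congr (1 - _); apply: eq_bigr => i _; rewrite mxE.
by rewrite cb mulmxN [X in _ = X + _]mxE; ring.
Qed.

Let V : set 'rV[R]_(m * n) := range pvertex.

(** Barycentric coordinates are nonnegative on the product of simplices, so one
    that is negative at [x] separates [x] from it. *)
Lemma exposed_by_negative_coord x j o :
  bary_coord x j o < 0 -> strictly_exposed (V `|` [set x]) x.
Proof.
move=> lx; apply: (@affine_form_exposed _ _ (fun x => - 1 * bary_coord x j o)).
  by apply: affine_formZ; apply: affine_form_bary_coord.
move=> w [[f _ <-]|->//] _; rewrite bary_coord_pvertex.
by have : 0 <= (f j == o)%:R :> R; [rewrite ler0n | lra].
Qed.

(** The sum of the [m] coordinates that equal 1 at the vertex [f] exposes it
    among the vertices of the product.  Subtracting a multiple of a coordinate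
    that vanishes there and is positive at [x] only helps against the other
    vertices, and with a large factor it also pushes the value at [x] down. *)
Lemma exposed_pvertex f x :
  x = pvertex f \/ (exists j o, o != f j /\ 0 < bary_coord x j o) ->
  strictly_exposed (V `|` [set x]) (pvertex f).
Proof.
move=> xf; pose G y := \sum_j bary_coord y j (f j).
have Gaff : affine_form G.
  by apply: affine_form_sum => j; apply: affine_form_bary_coord.
have Gf : G (pvertex f) = m%:R.
  rewrite /G (eq_bigr (fun=> 1)) => [|j _]; last first.
    by rewrite bary_coord_pvertex eqxx.
  by rewrite sumr_const card_ord.
have Gg g : g != f -> G (pvertex g) < m%:R.
  move=> gf; have [j gfj] : exists j, g j != f j.
    apply/existsP; rewrite -negb_forall; apply: contra gf => /forallP gf.
    by apply/eqP/ffunP => j; apply/eqP.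
  rewrite -Gf /G (bigD1 j) //= [ltRHS](bigD1 j) //= !bary_coord_pvertex eqxx.
  rewrite (negbTE gfj) ltr_leD ?ltr01 // ler_sum // => i _.
  by rewrite !bary_coord_pvertex eqxx; case: eqP => // _; rewrite ler01.
have m0 : 0 < m%:R :> R by rewrite ltr0n; apply: ltn_trans m_gt1.
case: xf => [xf|[j [o [of0 lx]]]].
  apply: (affine_form_exposed Gaff) => w [[g _ <-]|->//] wf; rewrite Gf.
  by apply: Gg; apply: contra_notN wf => /eqP ->.
(* With this factor the form is at most 0 at x, while it is m at the vertex. *)
pose B := `|G x| / bary_coord x j o.
apply: (@affine_form_exposed _ _ (fun y => G y + (- B) * bary_coord y j o)).
  apply: affine_formD => //.
  by apply: affine_formZ; apply: affine_form_bary_coord.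
move=> w [[g _ <-]|->] wf; rewrite Gf !bary_coord_pvertex (eq_sym (f j));
  rewrite (negbTE of0) mulr0 addr0.
  have : 0 <= B * (g j == o)%:R by rewrite mulr_ge0 ?ler0n // divr_ge0 // ltW.
  have : G (pvertex g) < m%:R by apply: Gg; apply: contra_notN wf => /eqP ->.
  lra.
rewrite mulNr /B mulfVK ?gt_eqF //.
by have := ler_norm (G x); lra.
Qed.

Lemma vertices_product : vertices (conv_hull V) = V.
Proof.
apply: vertices_conv_hull => _ [f _ <-].
apply: (@strictly_exposedS _ _ (V `|` [set pvertex f])); first by left.
by apply: exposed_pvertex; left.
Qed.

Lemma insertable_product x :
  lattice x -> cube k x -> ~ V x -> insertable (conv_hull V) x.
Proof.
move=> Lx Cx nVx; have [_ _ movx] := movA.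
have inside j := (movx _ (lattice_row j Lx) (cube_row j Cx)).1.
have opposite j := (movx _ (lattice_row j Lx) (cube_row j Cx)).2.
apply: insertable_conv_hull => // [_ [f _ <-]|].
  apply: exposed_pvertex; right; apply: contrapT => nex; apply: nVx.
  exists f => //; apply/esym/eq_pvertex => j; apply: opposite => o of0.
  by rewrite leNgt; apply/negP => lx; apply: nex; exists j, o.
have [j [o lx]] : exists j o, bary_coord x j o < 0.
  apply: contrapT => nex; apply: nVx.
  have /choice[f fx] j : exists o, row j (coords x) = corner R o.
    apply: inside => o; rewrite leNgt; apply/negP => lx; apply: nex.
    by exists j, o.
  by exists (finfun f) => //; apply/esym/eq_pvertex => j; rewrite ffunE.
exact: exposed_by_negative_coord lx.
Qed.

(** The origin and the points with a single nonzero component, equal to a row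
    of [A], are vertices of the product, and they span the space affinely. *)
Lemma affine_set_full S : affine_set S -> V `<=` S -> S = setT.
Proof.
move=> aS VS; apply/seteqP; split=> // x _; rewrite -[x]coordsK.
pose f0 : corners := [ffun=> None].
have S0 : S 0.
  have <- : pvertex f0 = 0; last by apply: VS; exists f0.
  rewrite /pvertex /point (_ : corner_mx f0 = 0) ?mul0mx ?linear0 //.
  by apply/row_matrixP => j; rewrite rowK ffunE row0.
have Sdelta j i : S (point (delta_mx j i)).
  apply: VS; exists [ffun l => if l == j then Some i else None] => //.
  congr point; apply/matrixP => l p; rewrite !mxE ffunE.
  by case: (l == j); rewrite mxE.
rewrite [coords x]matrix_sum_delta pair_big /=.
elim/big_rec: _ => [|[j i] Z _ SZ]; first by rewrite /point mul0mx linear0.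
rewrite (_ : point _ = point Z + coords x j i *: (point (delta_mx j i) - 0)).
  exact: affine_set_translate.
by rewrite /point mulmxDl -scalemxAl addrC linearD linearZ subr0.
Qed.

Lemma has_dim_product : has_dim (conv_hull V) (m * n).
Proof. exact/has_dim_conv_hull/affine_set_full. Qed.

(** Moving two distinct components of [f] to other vertices of the simplex,
    separately and jointly, gives three vertices forming a parallelogram with
    [f]; the affine span of the remaining vertices therefore recovers [f]. *)
Lemma deletable_product f : deletable (conv_hull V) (pvertex f).
Proof.
rewrite /deletable vertices_product; split; first by exists f.
apply: has_dim_conv_hull => S aS VS; apply: affine_set_full => // _ [g _ <-].
have Sg h : h != f -> S (pvertex h).
  move=> hf; apply: VS; split; first by exists h.
  by move/pvertex_inj => hf'; rewrite hf' eqxx in hf.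
have [->|/Sg//] := eqVneq g f.
pose other (o : option 'I_n) :=
  if o is Some _ then None else Some (Ordinal n_gt0).
have otherP o : other o != o by case: o.
pose j0 := Ordinal (ltnW m_gt1); pose j1 := Ordinal m_gt1.
pose swap (b0 b1 : bool) : corners :=
  [ffun j => if (j == j0) && b0 || (j == j1) && b1 then other (f j) else f j].
have swapP b0 b1 j : (j == j0) && b0 || (j == j1) && b1 -> swap b0 b1 != f.
  move=> bj; apply/eqP => /ffunP/(_ j); rewrite ffunE bj => /eqP.
  by rewrite (negbTE (otherP _)).
have -> : pvertex f = pvertex (swap true false) +
    1 *: (pvertex (swap false true) - pvertex (swap true true)).
  rewrite scale1r /pvertex /point -linearB -linearD -mulmxBl -mulmxDl.
  congr (mxvec (_ *m _)).
  apply/row_matrixP => j.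
  rewrite !linearD linearN /= !rowK !ffunE !andbT !andbF orbF.
  have [->|_] := eqVneq j j0; rewrite /=; first by rewrite addrC subrK.
  by rewrite addrC; case: (j == j1); rewrite ?subrr ?add0r ?subrK.
by apply: affine_set_translate => //; apply: Sg;
  [apply: (swapP _ _ j0) | apply: (swapP _ _ j1) | apply: (swapP _ _ j0)];
  rewrite ?eqxx ?orbT.
Qed.

(** The vertices are indexed by choosing one of the [n + 1] corners in each of
    the [m] factors, which gives their number. *)
Lemma movable_product : exists P : set 'rV[R]_(m * n),
  [/\ lattice_polytope P,
      has_dim P (m * n),
      (vertices P #= `I_(n.+1 ^ m))%card,
      P `<=` cube k
    & forall x : 'rV[R]_(m * n), lattice x -> cube k x ->
        insertable P x \/ deletable P x].
Proof.
exists (conv_hull V); split; last 1 first.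
- move=> x Lx Cx; have [[f _ <-]|nVx] := pselect (V x).
    by right; apply: deletable_product.
  by left; apply: insertable_product.
- split; last by rewrite vertices_product => _ [f _ <-]; apply: lattice_pvertex.
  by exists V; split=> //; apply: finite_image; apply: finite_finset.
- exact: has_dim_product.
- rewrite vertices_product.
  have <- : #|{: corners}| = (n.+1 ^ m)%N.
    by rewrite card_ffun card_option !card_ord.
  exact: card_range_fin pvertex_inj.
- apply: conv_hull_min; last by move=> _ [f _ <-]; apply: cube_pvertex.
  apply: convex_setP => x y t t0 t1 Cx Cy p.
  by have := Cx p; have := Cy p; rewrite !mxE => /andP[? ?] /andP[? ?]; nra.
Qed.

End ProductOfSimplices.

(** * The cyclic simplex, for sides at least 3 *)

Section CyclicSimplex.
Local Open Scope ring_scope.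
Variables (R : realType) (k : nat).
Hypothesis k_gt2 : (2 < k)%N.
Implicit Types (y : 'rV[R]_k.+1) (i j : 'I_k.+1).

(** Row [i] is [(k - 1) e_i + e_{i+1}], with indices modulo [k + 1]. *)
Definition cyclic_mx : 'M[R]_k.+1 :=
  \matrix_(i, j) ((k%:R - 1) * (i == j)%:R + (i == ord_pred j)%:R).

Lemma int_gt0_ge1 (x : R) : x \is a Num.int -> 0 < x -> 1 <= x.
Proof. by move=> /intrP[z ->]; rewrite ltr0z ler1z gtz0_ge1. Qed.

Let c_gt1 : 1 < k%:R - 1 :> R.
Proof. by rewrite ltrBrDr -(natrD R 1 1) ltr_nat. Qed.

Lemma mul_cyclic_mx y j :
  (y *m cyclic_mx) 0 j = (k%:R - 1) * y 0 j + y 0 (ord_pred j).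
Proof.
rewrite mxE; under eq_bigr do rewrite mxE mulrDr mulrCA !mulr_natr !mulrb.
rewrite big_split /= -mulr_sumr.
by rewrite -!big_mkcond /= !big_pred1_eq.
Qed.

Lemma sum_ord_pred (F : 'I_k.+1 -> R) : \sum_j F (ord_pred j) = \sum_j F j.
Proof. by rewrite [RHS](reindex_inj (can_inj (@ord_predK k.+1))). Qed.

Lemma sum_cyclic_mx y : \sum_j (y *m cyclic_mx) 0 j = k%:R * \sum_j y 0 j.
Proof.
under eq_bigr do rewrite mul_cyclic_mx.
by rewrite big_split /= -mulr_sumr (sum_ord_pred (y 0)); ring.
Qed.

(** On the kernel, consecutive entries are proportional in absolute value with
    ratio [k - 1 > 1]; summing around the cycle forces them to vanish. *)
Lemma cyclic_mx_unit : cyclic_mx \in unitmx.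
Proof.
rewrite -row_free_unit; apply: inj_row_free => y y0.
have ynorm j : `|y 0 (ord_pred j)| = (k%:R - 1) * `|y 0 j|.
  have := mul_cyclic_mx y j; rewrite y0 mxE => /esym/eqP.
  rewrite addr_eq0 => /eqP/(congr1 Num.norm).
  by rewrite normrN normrM gtr0_norm //; apply: lt_trans c_gt1.
have s0 : \sum_j `|y 0 j| = 0.
  have := sum_ord_pred (fun j => `|y 0 j|).
  under eq_bigr do rewrite ynorm.
  by rewrite -mulr_sumr => s; have := c_gt1; nra.
apply/rowP => j; rewrite mxE; apply/eqP; rewrite -normr_eq0; apply/eqP.
by apply: (psumr_eq0P _ s0).
Qed.

(** Stepping backwards around the cycle reaches every index. *)
Lemma ord_pred_ind (Q : pred 'I_k.+1) j :
  Q j -> (forall i, Q i -> Q (ord_pred i)) -> forall i, Q i.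
Proof.
move=> Qj Qpred.
have down (a b : nat) (ha : (a < k.+1)%N) (hb : (b < k.+1)%N) :
    (a <= b)%N -> Q (Ordinal hb) -> Q (Ordinal ha).
  elim: b hb => [|b IH] hb ab Qb.
    by rewrite (_ : Ordinal ha = Ordinal hb) //; apply: val_inj => /=; lia.
  have [ab'|ba] := leqP a b; last first.
    by rewrite (_ : Ordinal ha = Ordinal hb) //; apply: val_inj => /=; lia.
  apply: (IH (ltnW hb)) => //; rewrite (_ : Ordinal _ = ord_pred (Ordinal hb)).
    exact: Qpred.
  by apply: val_inj; rewrite /= modnDr modn_small //; lia.
have Q0 : Q ord0.
  apply: (down 0 j _ (ltn_ord j)) => //.
  by rewrite (_ : Ordinal _ = j) //; apply: val_inj.
move=> i; have := down i k (ltn_ord i) (ltnSn k).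
rewrite (_ : Ordinal (ltn_ord i) = i); last exact: val_inj.
apply; first by rewrite -ltnS.
rewrite (_ : Ordinal _ = ord_pred ord0); first exact: Qpred.
by apply: val_inj; rewrite /= modn_small.
Qed.

Lemma corner_of_ge0 y j :
  (forall i, 0 <= y 0 i) -> \sum_i y 0 i <= 1 -> 1 <= y 0 j ->
  y = corner R (Some j).
Proof.
move=> y0 ys yj.
have := ys; rewrite (bigD1 j) //= => ys'.
have r0 : 0 <= \sum_(i | i != j) y 0 i by apply: sumr_ge0.
have r0' : \sum_(i | i != j) y 0 i = 0 by lra.
apply/rowP => i; rewrite /= mxE /=; have [->|ij] := eqVneq i j.
  by apply/eqP; rewrite eq_le yj andbT; move: ys'; rewrite r0' addr0.
by rewrite (psumr_eq0P _ r0').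
Qed.

Lemma ordSS_neq j : ordS (ordS j) != j.
Proof.
apply/eqP => /(congr1 val) /=; rewrite -addn1 modnDml addn1.
have [jk|kj] := ltnP j.+2 k.+1; first by rewrite modn_small //; lia.
have -> : j.+2 = (j.+1 - k + k.+1)%N by lia.
rewrite modnDr modn_small; have := ltn_ord j; lia.
Qed.

Lemma ordS_neq j : ordS j != j.
Proof. by apply: contraNneq (ordSS_neq j) => Sj; rewrite !Sj. Qed.

Lemma ord_pred_neq j : ord_pred j != j.
Proof. by rewrite -{2}[j]ord_predK eq_sym ordS_neq. Qed.

(** A zero entry must exist because the [k + 1] entries sum to at most [k].
    It makes some [y_i] vanish, and then an entry at which the [y_i] drop from
    nonzero to zero is a positive integer equal to one of them. *)
Lemma cyclic_simplex_inside y :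
  lattice (y *m cyclic_mx) -> cube k (y *m cyclic_mx) ->
  (forall o, 0 <= bary y o) -> exists o, y = corner R o.
Proof.
move=> Ly Cy yge0; have y0 i : 0 <= y 0 i := yge0 (Some i).
have ys : \sum_i y 0 i <= 1 by have := yge0 None; rewrite /= subr_ge0.
have [j xj] : exists j, (y *m cyclic_mx) 0 j = 0.
  apply: contrapT => nex.
  have : \sum_(j < k.+1) (1 : R) <= \sum_j (y *m cyclic_mx) 0 j.
    apply: ler_sum => j _; apply: int_gt0_ge1; first exact: Ly.
    have /andP[xj _] := Cy j; rewrite lt_neqAle xj andbT eq_sym.
    by apply/eqP => xj0; apply: nex; exists j.
  rewrite sumr_const card_ord sum_cyclic_mx -natr1.
  have := ler0n R k; nra.
have yj : y 0 j = 0.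
  move: xj; rewrite mul_cyclic_mx.
  by have := y0 j; have := y0 (ord_pred j); have := c_gt1; nra.
have [ex|nex] := pselect (exists i, y 0 i = 0 /\ y 0 (ord_pred i) != 0);
  last first.
  exists None; apply/rowP => i; rewrite /= mxE; apply/eqP.
  apply: (@ord_pred_ind (fun i => y 0 i == 0) j) => [|{}i /eqP yi].
    exact/eqP.
  by apply/negPn/negP => yi'; apply: nex; exists i.
case: ex => i [yi yi']; exists (Some (ord_pred i)); apply: corner_of_ge0 => //.
have := Ly i; rewrite mul_cyclic_mx yi mulr0 add0r => yint.
by apply: int_gt0_ge1 => //; rewrite lt_neqAle eq_sym yi' y0.
Qed.

(** An entry that combines two nonpositive coordinates is both nonnegative and
    nonpositive, so these coordinates vanish.  When the cone is at the vertex
    [j], this leaves [y_j] alone, which is then the entry of the point at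
    [j + 1]. *)
Lemma cyclic_simplex_opposite y o :
  lattice (y *m cyclic_mx) -> cube k (y *m cyclic_mx) ->
  (forall o', o' != o -> bary y o' <= 0) -> y = corner R o.
Proof.
move=> Ly Cy yo.
have zero i : y 0 i <= 0 -> y 0 (ord_pred i) <= 0 ->
    y 0 i = 0 /\ y 0 (ord_pred i) = 0.
  have := Cy i; rewrite mul_cyclic_mx => /andP[? _].
  by have := c_gt1; split; nra.
case: o yo => [j|] yo; last first.
  have y_le0 i : y 0 i <= 0 by apply: (yo (Some i)).
  by apply/rowP => i; rewrite /= mxE; case: (zero i).
have y_le0 i : i != j -> y 0 i <= 0 by move=> ij; apply: (yo (Some i)).
have y_eq0 i : i != j -> y 0 i = 0.
  move=> ij; have [pij|pij] := eqVneq (ord_pred i) j; last first.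
    by have [] := zero i (y_le0 _ ij) (y_le0 _ pij).
  have Sij : ordS i != j by rewrite -pij -{1}[i]ord_predK ordSS_neq.
  by have := zero (ordS i) (y_le0 _ Sij); rewrite ordSK => /(_ (y_le0 _ ij))[].
have yj1 : 1 <= y 0 j.
  have := yo None isT; rewrite /= (bigD1 j) //= big1 ?addr0 ?subr_le0 //.
have yint : y 0 j \is a Num.int.
  have := Ly (ordS j); rewrite mul_cyclic_mx ordSK.
  by rewrite [y 0 (ordS j)]y_eq0 ?mulr0 ?add0r //; apply: ordS_neq.
have yj_le1 : y 0 j <= 1.
  have /andP[_] := Cy j; rewrite mul_cyclic_mx.
  rewrite [y 0 (ord_pred j)]y_eq0 ?ord_pred_neq // addr0.
  move=> yjk; rewrite leNgt; apply/negP => yj_gt1.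
  have : 1 <= y 0 j - 1 by rewrite int_gt0_ge1 ?rpredB ?rpred1 // subr_gt0.
  have : 3 <= k%:R :> R by rewrite ler_nat.
  nra.
apply/rowP => i; rewrite /= mxE /=; have [->|/y_eq0 //] := eqVneq i j.
by apply/eqP; rewrite eq_le yj_le1 yj1.
Qed.

Lemma cyclic_simplex_movable : movable_simplex k cyclic_mx.
Proof.
split; first exact: cyclic_mx_unit.
- move=> o; split=> j; rewrite mul_cyclic_mx.
  + rewrite rpredD ?rpredM ?rpredB ?rpred_nat ?rpred1 //;
      by case: o => [i|]; rewrite /= mxE ?rpred0 ?rpred_nat.
  + have k1 := c_gt1.
    case: o => [i|]; rewrite /= !mxE /=; last by rewrite mulr0 addr0 lexx ler0n.
    have [->|_] := eqVneq j i.
      by rewrite (negbTE (ord_pred_neq i)) mulr1 addr0; lra.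
    by case: eqP => _; rewrite /=; lra.
- move=> y Ly Cy; split=> [|o]; first exact: cyclic_simplex_inside.
  exact: cyclic_simplex_opposite.
Qed.

End CyclicSimplex.

(** * The simplex in the cube of side 2 *)

Section SmallSimplex.
Local Open Scope ring_scope.
Variable R : realType.

Let i0 : 'I_3 := @Ordinal 3 0 isT.
Let i1 : 'I_3 := @Ordinal 3 1 isT.
Let i2 : 'I_3 := @Ordinal 3 2 isT.

(** The matrix has determinant 1 in absolute value, so lattice points have
    integer coordinates. *)
Definition small_mx : 'M[R]_3 :=
  \matrix_(i, j)
    (nth 0%N (nth [::] [:: [:: 0; 1; 2]; [:: 1; 2; 2]; [:: 2; 2; 1]]%N i) j)%:R.

Lemma forall_ord3 (Q : 'I_3 -> Prop) : Q i0 -> Q i1 -> Q i2 -> forall i, Q i.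
Proof.
by move=> Q0 Q1 Q2 [[|[|[|//]]] ilt]; [move: Q0|move: Q1|move: Q2];
  congr Q; apply: val_inj.
Qed.

Lemma sum_ord3 (F : 'I_3 -> R) : \sum_i F i = F i0 + F i1 + F i2.
Proof.
rewrite !big_ord_recl big_ord0 addr0 addrA.
by congr (F _ + F _ + F _); apply: val_inj.
Qed.

Lemma mul_small_mx (y : 'rV[R]_3) :
  [/\ (y *m small_mx) 0 i0 = y 0 i1 + 2 * y 0 i2,
      (y *m small_mx) 0 i1 = y 0 i0 + 2 * y 0 i1 + 2 * y 0 i2
    & (y *m small_mx) 0 i2 = 2 * y 0 i0 + 2 * y 0 i1 + y 0 i2].
Proof. by split; rewrite mxE sum_ord3 !mxE /=; ring. Qed.

Lemma small_mx_unit : small_mx \in unitmx.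
Proof.
rewrite -row_free_unit; apply: inj_row_free => y y0.
have [] := mul_small_mx y; rewrite y0 !mxE => e0 e1 e2.
by apply/rowP; apply: forall_ord3; rewrite mxE; lra.
Qed.

Lemma small_simplex_int (y : 'rV[R]_3) :
  lattice (y *m small_mx) -> cube 2 (y *m small_mx) ->
  exists a b c : int,
    [/\ y 0 i0 = a%:~R, y 0 i1 = b%:~R & y 0 i2 = c%:~R] /\
    [/\ 0 <= b + 2 * c <= 2, 0 <= a + 2 * b + 2 * c <= 2
      & 0 <= 2 * a + 2 * b + c <= 2].
Proof.
move=> Ly Cy; have [e0 e1 e2] := mul_small_mx y.
have /intrP[p ep] := Ly i0; have /intrP[q eq] := Ly i1.
have /intrP[r er] := Ly i2.
have := Cy i2; have := Cy i1; have := Cy i0.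
rewrite ep eq er -[2%:R]/(2%:~R) !ler0z !ler_int => Cp Cq Cr.
(* These are the entries of (p, q, r) times the inverse matrix. *)
exists (2 * r - 3 * q + 2 * p), (4 * q - 2 * r - 3 * p), (r - 2 * q + 2 * p).
split; last by split; lia.
move: e0 e1 e2; rewrite ep eq er => e0 e1 e2.
by split; lra.
Qed.

Lemma small_simplex_movable : movable_simplex 2 small_mx.
Proof.
split; first exact: small_mx_unit.
- have nat_entry o j :
      exists2 e : nat, (corner R o *m small_mx) 0 j = e%:R & (e <= 2)%N.
    case: o => [i|]; last by exists 0%N; rewrite // mul0mx mxE.
    rewrite /= -rowE !mxE; eexists; first by [].
    by move: i; apply: forall_ord3; move: j; apply: forall_ord3.
  move=> o; split=> j; have [e -> e2] := nat_entry o j; first exact: natr_int.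
  by rewrite ler0n ler_nat.
move=> y Ly Cy.
have [a [b [c [[ya yb yc] [Cp Cq Cr]]]]] := small_simplex_int Ly Cy.
have bary_int o : bary y o =
    (if o is Some i then nth 0 [:: a; b; c] i else 1 - (a + b + c))%:~R.
  case: o => [|] /=; first exact: forall_ord3.
  by rewrite sum_ord3 ya yb yc; ring.
have corner_int o : [&& a == (o == Some i0), b == (o == Some i1)
    & c == (o == Some i2)] -> y = corner R o.
  case/and3P => /eqP ea /eqP eb /eqP ec.
  have cornerE i : corner R o 0 i = (o == Some i)%:R.
    exact: bary_corner o (Some i).
  by apply/rowP; apply: forall_ord3; rewrite cornerE ?ya ?yb ?yc ?ea ?eb ?ec.
split=> [ge0|o le0].
  have := ge0 None; have := ge0 (Some i0); have := ge0 (Some i1).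
  have := ge0 (Some i2); rewrite !bary_int !ler0z /= => c0 b0 a0 s0.
  have : [|| [&& a == 0, b == 0 & c == 0], [&& a == 1, b == 0 & c == 0],
    [&& a == 0, b == 1 & c == 0] | [&& a == 0, b == 0 & c == 1]] by lia.
  case/or4P => abc.
  - by exists None; apply: corner_int.
  - by exists (Some i0); apply: corner_int.
  - by exists (Some i1); apply: corner_int.
  - by exists (Some i2); apply: corner_int.
apply: corner_int.
have := le0 None; have := le0 (Some i0); have := le0 (Some i1).
have := le0 (Some i2); rewrite !bary_int !lerz0 /=.
case: o {le0} => [|] /=; last by lia.
by apply: forall_ord3 => /=; lia.
Qed.
End SmallSimplex.

(** * The polytope *)

Theorem theorem5p4 (R : realType) (k d : nat)
    (hk : (2 <= k)%N) (hd : (0 < d)%N)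
    (hdvd : (k.+1 %| d)%N) (hproper : k.+1 <> d) :
  exists P : set 'rV[R]_d,
    [/\ lattice_polytope P,
        has_dim P d,
        (vertices P #= `I_((k + 2) ^ (d %/ k.+1)))%card,
        P `<=` @cube R d k
      & forall x : 'rV[R]_d, @lattice R d x -> @cube R d k x ->
          insertable P x \/ deletable P x].
Proof.
case/dvdnP: hdvd hd hproper => m ->; rewrite muln_gt0 => /andP[m_gt0 _] hproper.
have m_gt1 : (1 < m)%N.
  rewrite ltn_neqAle m_gt0 andbT.
  by apply: contra_notN hproper => /eqP <-; rewrite mul1n.
have [A movA] : exists A : 'M[R]_k.+1, movable_simplex k A.
  have [k_gt2|k_le2] := ltnP 2 k.
    by exists (cyclic_mx R k); apply: cyclic_simplex_movable.
  have -> : k = 2 by apply/eqP; rewrite eqn_leq k_le2.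
  by exists (small_mx R); apply: small_simplex_movable.
by rewrite mulnK // addn2; apply: movable_product movA.
Qed.
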